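(* Let $f:\Omega_D\to\mathbb{H}$ be a slice regular function. Then for every $x\in\Omega_D$, $$\frac{\partial f}{\partial x}(x)=2\,\mathrm{Im}(x)\left(\frac{\partial}{\partial x}\partial_s f\right)(x)+\partial_s f(x).$$
   Context: $\mathbb{H}$ is the real algebra of quaternions and $\mathbb{S}=\{q\in\mathbb{H} : q^2=-1\}$; every $x\in\mathbb{H}$ can be written $x=\alpha+J\beta$ with $\alpha,\beta\in\mathbb{R}$, $J\in\mathbb{S}$, its conjugate is $x^c=\alpha-J\beta$ and $\mathrm{Im}(x)=J\beta$. $D\subset\mathbb{C}$ is an open set symmetric with respect to the real axis, and $\Omega_D:=\{\alpha+J\beta : \alpha+i\beta\in D,\ J\in\mathbb{S}\}$. Let $\mathbb{H}_{\mathbb{C}}=\mathbb{H}\otimes_{\mathbb{R}}\mathbb{C}=\{p+\sqrt{-1}q : p,q\in\mathbb{H}\}$. A stem function on $D$ is a map $F=F_1+\sqrt{-1}F_2:D\to\mathbb{H}_{\mathbb{C}}$ ($F_1,F_2$ being $\mathbb{H}$-valued) with $F_1(\bar z)=F_1(z)$, $F_2(\bar z)=-F_2(z)$; it induces the slice function $f=\mathcal{I}(F):\Omega_D\to\mathbb{H}$, $f(\alpha+J\beta):=F_1(\alpha+i\beta)+JF_2(\alpha+i\beta)$. The slice function $f=\mathcal{I}(F)$ is slice regular if $F$ is $\mathcal{C}^1$ and $\frac{\partial F}{\partial\bar z}=\frac12\left(\frac{\partial F}{\partial\alpha}+\sqrt{-1}\frac{\partial F}{\partial\beta}\right)\equiv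 0$. For a slice function $f=\mathcal{I}(F)$ with $F$ of class $\mathcal{C}^1$, the slice derivative is $\frac{\partial f}{\partial x}:=\mathcal{I}\left(\frac{\partial F}{\partial z}\right)$ with $\frac{\partial F}{\partial z}=\frac12\left(\frac{\partial F}{\partial\alpha}-\sqrt{-1}\frac{\partial F}{\partial\beta}\right)$. The spherical derivative is $\partial_s f(x):=\frac12\mathrm{Im}(x)^{-1}(f(x)-f(x^c))$ for $x\in\Omega_D\setminus\mathbb{R}$; it is the slice function induced by the stem function $z\mapsto F_2(z)/\mathrm{Im}(z)$. When $f$ is slice regular and $\Omega_D\cap\mathbb{R}\neq\emptyset$, $\partial_s f$ and its slice derivative $\frac{\partial}{\partial x}\partial_s f$ extend continuously to $\Omega_D$, and at real points the symbols denote these extensions. *)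

(* Defs.v *)
From HB Require Import structures.
From mathcomp Require Import all_boot all_order all_algebra.
From mathcomp Require Import all_classical all_reals all_analysis.
From mathcomp Require Import ring lra.

Set Implicit Arguments.
Unset Strict Implicit.
Unset Printing Implicit Defensive.

Import Order.TTheory GRing.Theory Num.Theory.
Import numFieldNormedType.Exports.

Local Open Scope classical_set_scope.
Local Open Scope ring_scope.

(* [(a, b, c, d)] stands for a + b i + c j + d k.  The alias is needed because
   the product type already carries the componentwise multiplication; only its
   normed R-module structure (hence the usual topology of R^4) is inherited. *)
Definition quat (R : realType) : Type := (R * R * R * R)%type.

HB.instance Definition _ (R : realType) :=
  NormedModule.copy (quat R) (R * R * R * R)%type.

Section QuaternionAlgebra.
Variable R : realType.
Implicit Types p q : quat R.

Definition qone : quat R := (1, 0, 0, 0).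

Definition qmul p q : quat R :=
  let: (a1, b1, c1, d1) := p in let: (a2, b2, c2, d2) := q in
  (a1 * a2 - b1 * b2 - c1 * c2 - d1 * d2,
   a1 * b2 + b1 * a2 + c1 * d2 - d1 * c2,
   a1 * c2 - b1 * d2 + c1 * a2 + d1 * b2,
   a1 * d2 + b1 * c2 - c1 * b2 + d1 * a2).

Lemma qaddE (a1 b1 c1 d1 a2 b2 c2 d2 : R) :
  (a1, b1, c1, d1) + (a2, b2, c2, d2) =
  (a1 + a2, b1 + b2, c1 + c2, d1 + d2) :> quat R.
Proof. by []. Qed.

Lemma qoppE (a b c d : R) : - (a, b, c, d) = (- a, - b, - c, - d) :> quat R.
Proof. by []. Qed.

Lemma qscaleE (t a b c d : R) :
  t *: ((a, b, c, d) : quat R) = (t * a, t * b, t * c, t * d).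
Proof. by []. Qed.

Lemma qzeroE : 0 = (0, 0, 0, 0) :> quat R.
Proof. by []. Qed.

Lemma qmulA : associative qmul.
Proof.
move=> [[[a1 b1] c1] d1] [[[a2 b2] c2] d2] [[[a3 b3] c3] d3].
by rewrite /qmul; congr (_, _, _, _); ring.
Qed.

Lemma qmul1q : left_id qone qmul.
Proof. by move=> [[[a b] c] d]; rewrite /qmul; congr (_, _, _, _); ring. Qed.

Lemma qmulq1 : right_id qone qmul.
Proof. by move=> [[[a b] c] d]; rewrite /qmul; congr (_, _, _, _); ring. Qed.

Lemma qmulDl : left_distributive qmul +%R.
Proof.
move=> [[[a1 b1] c1] d1] [[[a2 b2] c2] d2] [[[a3 b3] c3] d3].
by rewrite /qmul !qaddE; congr (_, _, _, _); ring.
Qed.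

Lemma qmulDr : right_distributive qmul +%R.
Proof.
move=> [[[a1 b1] c1] d1] [[[a2 b2] c2] d2] [[[a3 b3] c3] d3].
by rewrite /qmul !qaddE; congr (_, _, _, _); ring.
Qed.

Lemma qone_neq0 : qone != 0.
Proof. by apply/eqP => -[] /eqP; rewrite oner_eq0. Qed.

HB.instance Definition _ := GRing.Zmodule_isNzRing.Build (quat R)
  qmulA qmul1q qmulq1 qmulDl qmulDr qone_neq0.

Lemma qmulE (a1 b1 c1 d1 a2 b2 c2 d2 : R) :
  ((a1, b1, c1, d1) : quat R) * (a2, b2, c2, d2) =
  (a1 * a2 - b1 * b2 - c1 * c2 - d1 * d2,
   a1 * b2 + b1 * a2 + c1 * d2 - d1 * c2,
   a1 * c2 - b1 * d2 + c1 * a2 + d1 * b2,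
   a1 * d2 + b1 * c2 - c1 * b2 + d1 * a2).
Proof. by []. Qed.

Lemma qoneE : 1 = (1, 0, 0, 0) :> quat R.
Proof. by []. Qed.

Lemma qscaleAl (t : R) p q : t *: (p * q) = (t *: p : quat R) * q.
Proof.
case: p q => [[[a1 b1] c1] d1] [[[a2 b2] c2] d2].
by rewrite !(qmulE, qscaleE); congr (_, _, _, _); ring.
Qed.

HB.instance Definition _ := GRing.Lmodule_isLalgebra.Build R (quat R) qscaleAl.

Lemma qscaleAr (t : R) p q : t *: (p * q) = p * (t *: q : quat R).
Proof.
case: p q => [[[a1 b1] c1] d1] [[[a2 b2] c2] d2].
by rewrite !(qmulE, qscaleE); congr (_, _, _, _); ring.
Qed.

HB.instance Definition _ := GRing.Lalgebra_isAlgebra.Build R (quat R) qscaleAr.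

Definition qRe q : R := let: (a, _, _, _) := q in a.
Definition qconj q : quat R := let: (a, b, c, d) := q in (a, - b, - c, - d).
Definition qIm q : quat R := let: (_, b, c, d) := q in (0, b, c, d).
Definition qnorm2 q : R :=
  let: (a, b, c, d) := q in a ^+ 2 + b ^+ 2 + c ^+ 2 + d ^+ 2.

(* The Euclidean absolute value; the canonical norm [`|q|] of the product type
   is the maximum norm, which only serves to define the topology. *)
Definition qabs q : R := Num.sqrt (qnorm2 q).

Lemma qnorm2_ge0 q : 0 <= qnorm2 q.
Proof. by case: q => [[[a b] c] d]; rewrite /qnorm2 !addr_ge0 ?sqr_ge0. Qed.

Lemma qnorm2_eq0 q : (qnorm2 q == 0) = (q == 0).
Proof.
apply/eqP/eqP => [|->]; last by rewrite qzeroE /qnorm2 expr0n /= !addr0.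
case: q => [[[a b] c] d]; rewrite /qnorm2 => h.
have [ha hb hc hd] : [/\ a = 0, b = 0, c = 0 & d = 0].
  by split; apply/eqP; rewrite -sqrf_eq0; apply/eqP;
    move: (sqr_ge0 a) (sqr_ge0 b) (sqr_ge0 c) (sqr_ge0 d); lra.
by rewrite ha hb hc hd.
Qed.

Definition qinv q : quat R := (qnorm2 q)^-1 *: qconj q.

Lemma qmulVq : {in [pred q | q != 0], left_inverse 1 qinv *%R}.
Proof.
move=> q; rewrite inE -qnorm2_eq0 /qinv => nz.
case: q nz => [[[a b] c] d]; rewrite /qnorm2 => nz.
by rewrite /qconj qscaleE qmulE qoneE; congr (_, _, _, _); field.
Qed.

Lemma qmulqV : {in [pred q | q != 0], right_inverse 1 qinv *%R}.
Proof.
move=> q; rewrite inE -qnorm2_eq0 /qinv => nz.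
case: q nz => [[[a b] c] d]; rewrite /qnorm2 => nz.
by rewrite /qconj qscaleE qmulE qoneE; congr (_, _, _, _); field.
Qed.

Lemma qunitP p q : q * p = 1 /\ p * q = 1 -> [pred q | q != 0] p.
Proof.
by move=> [h _] /=; apply/eqP => p0; move: h; rewrite p0 mulr0 => /esym/eqP;
  rewrite oner_eq0.
Qed.

Lemma qinv_out : {in [predC [pred q | q != 0]], qinv =1 id}.
Proof.
move=> q; rewrite !inE negbK => /eqP ->.
by rewrite /qinv qzeroE /qconj qscaleE !oppr0 !mulr0.
Qed.

HB.instance Definition _ := GRing.NzRing_hasMulInverse.Build (quat R)
  qmulVq qmulqV qunitP qinv_out.

Definition imag_sphere : set (quat R) := [set J | J ^+ 2 = -1].

Definition qi : quat R := (0, 1, 0, 0).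

(* An imaginary unit J with [x = Re x + |Im x| J]; at real x, where every J
   qualifies, it is chosen to be i. *)
Definition imag_unit (x : quat R) : quat R :=
  if qIm x == 0 then qi else (qabs (qIm x))^-1 *: qIm x.

End QuaternionAlgebra.

(* C is identified with R^2, alpha + i beta being [(alpha, beta)], and
   H (x) C with H^2, p + sqrt(-1) q being [(p, q)]. *)
Notation cplane R := (R * R)%type.
Notation HC R := (quat R * quat R)%type.

Section SliceFunctions.
Variable R : realType.
Implicit Types (D : set (cplane R)) (F : cplane R -> HC R).
Implicit Types (f g : quat R -> quat R) (x : quat R).

Definition cconj (z : cplane R) : cplane R := (z.1, - z.2).

Definition conj_symmetric D := forall z, D z -> D (cconj z).

Definition Omega D : set (quat R) :=
  [set x | exists a b J, [/\ D (a, b), imag_sphere J & x = a%:A + b *: J]].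

(* multiplication by sqrt(-1) *)
Definition HCi (w : HC R) : HC R := (- w.2, w.1).

(* Functions on D and on Omega D are represented by total functions, of which
   only the values on D and on Omega D are constrained. *)
Definition is_stem D F := forall z, D z ->
  (F (cconj z)).1 = (F z).1 /\ (F (cconj z)).2 = - (F z).2.

(* [sliceI F (alpha + J beta) = F_1(alpha + i beta) + J F_2(alpha + i beta)],
   see [sliceIE]. *)
Definition sliceI F x : quat R :=
  let z := (qRe x, qabs (qIm x)) in (F z).1 + imag_unit x * (F z).2.

Definition induces D F f := is_stem D F /\ {in Omega D, f =1 sliceI F}.

Definition d_alpha F : cplane R -> HC R := fun z => 'D_((1, 0) : cplane R) F z.
Definition d_beta F : cplane R -> HC R := fun z => 'D_((0, 1) : cplane R) F z.

Definition d_z F : cplane R -> HC R :=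
  fun z => 2^-1 *: (d_alpha F z - HCi (d_beta F z)).
Definition d_zbar F : cplane R -> HC R :=
  fun z => 2^-1 *: (d_alpha F z + HCi (d_beta F z)).

Definition is_C1 D F := forall z, D z ->
  [/\ derivable F z ((1, 0) : cplane R), derivable F z ((0, 1) : cplane R),
      {for z, continuous (d_alpha F)} & {for z, continuous (d_beta F)}].

Definition slice_regular D f := exists F,
  [/\ induces D F f, is_C1 D F & forall z, D z -> d_zbar F z = 0].

(* The stem function of a slice function is unique on D, see
   [stem_function_unique]. *)
Definition stem_function D f : cplane R -> HC R :=
  xget (cst 0) [set F | induces D F f].

Definition slice_derivative D f : quat R -> quat R :=
  sliceI (d_z (stem_function D f)).

Definition spherical_derivative f x : quat R :=
  2^-1 *: ((qIm x)^-1 * (f x - f (qconj x))).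

(* [Omega (off_real D)] is [Omega D] minus the real axis. *)
Definition off_real D : set (cplane R) := D `&` [set z | z.2 != 0].

(* At a real point, the value of the continuous extension of [g] is its limit
   along the non-real points of Omega D. *)
Definition extend_real D g x : quat R :=
  if qIm x == 0 then lim (g y @[y --> within (Omega (off_real D)) (nbhs x)])
  else g x.

Lemma imag_sphereP (J : quat R) :
  imag_sphere J <-> qRe J = 0 /\ qnorm2 J = 1.
Proof.
case: J => [[[a b] c] d]; rewrite /imag_sphere /= expr2 qmulE qoneE qoppE.
split=> [[h1 h2 h3 h4]|[-> h]]; last by congr (_, _, _, _); lra.
have a0 : a = 0.
  case: (eqVneq a 0) => // a0.
  have z (t : R) : a * t + t * a = 0 -> t = 0.
    by rewrite [t * a]mulrC -mulr2n => /eqP; rewrite mulrn_eq0 /= mulf_eq0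
      (negPf a0) => /eqP.
  have b0 : b = 0 by apply: z; lra.
  have c0 : c = 0 by apply: z; lra.
  have d0 : d = 0 by apply: z; lra.
  move: h1; rewrite b0 c0 d0 => h1.
  by have := sqr_ge0 a; rewrite expr2; lra.
by split=> //; move: h1; rewrite a0 !expr2; lra.
Qed.

Lemma qRe_slice (a b : R) (J : quat R) : imag_sphere J ->
  qRe (a%:A + b *: J) = a.
Proof.
move=> /imag_sphereP[]; case: J => [[[j0 j1] j2] j3]; rewrite {1}/qRe => -> _.
by rewrite qoneE !qscaleE qaddE /qRe mulr1 mulr0 addr0.
Qed.

Lemma qIm_slice (a b : R) (J : quat R) : imag_sphere J ->
  qIm (a%:A + b *: J) = b *: J.
Proof.
move=> /imag_sphereP[]; case: J => [[[j0 j1] j2] j3]; rewrite {1}/qRe => -> _.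
by rewrite qoneE !qscaleE qaddE /qIm !mulr0 !add0r.
Qed.

Lemma qconj_slice (a b : R) (J : quat R) : imag_sphere J ->
  qconj (a%:A + b *: J) = a%:A + (- b) *: J.
Proof.
move=> /imag_sphereP[]; case: J => [[[j0 j1] j2] j3]; rewrite {1}/qRe => -> _.
rewrite qoneE !qscaleE !qaddE /qconj; congr (_, _, _, _); ring.
Qed.

Lemma qabs_slice (b : R) (J : quat R) : imag_sphere J ->
  qabs (b *: J) = `|b|.
Proof.
move=> /imag_sphereP[]; case: J => [[[j0 j1] j2] j3] /= -> h.
rewrite /qabs /= -sqrtr_sqr; congr Num.sqrt.
by rewrite !exprMn -!mulrDr h mulr1.
Qed.

Lemma qi_sphere : imag_sphere (qi R).
Proof. by apply/imag_sphereP; split=> //=; rewrite !expr2; ring. Qed.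

Lemma imag_sphere_neq0 (J : quat R) : imag_sphere J -> J != 0.
Proof.
by move=> /imag_sphereP[_ h]; rewrite -qnorm2_eq0 h oner_eq0.
Qed.

Lemma Omega_slice D (a b : R) (J : quat R) :
  D (a, b) -> imag_sphere J -> Omega D (a%:A + b *: J).
Proof. by move=> Dab SJ; exists a, b, J. Qed.

Lemma sliceIE D F (a b : R) (J : quat R) :
  is_stem D F -> D (a, b) -> imag_sphere J ->
  sliceI F (a%:A + b *: J) = (F (a, b)).1 + J * (F (a, b)).2.
Proof.
move=> stF Dab SJ; rewrite /sliceI qRe_slice// qIm_slice// qabs_slice//.
rewrite /imag_unit qIm_slice// qabs_slice// scaler_eq0.
rewrite (negPf (imag_sphere_neq0 SJ)) orbF.
have [b0|bn0 /=] := eqVneq b 0.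
  move: (stF _ Dab); rewrite b0 /cconj /= oppr0 normr0 => -[_ h].
  suff -> : (F (a, 0)).2 = 0 by rewrite !mulr0.
  have : 2%:R *: (F (a, 0)).2 = 0.
    by rewrite scaler_nat mulr2n {1}h addNr.
  by move=> /eqP; rewrite scaler_eq0 pnatr_eq0 /= => /eqP.
rewrite scalerA; have [b0|b0] := ger0P b.
  by rewrite mulVf ?scale1r.
have [h1 h2] := stF _ Dab; rewrite /cconj/= in h1 h2.
by rewrite h1 h2 invrN mulNr mulVf// scaleN1r mulrNN.
Qed.

Lemma stem_function_unique D F F' f : conj_symmetric D ->
  induces D F f -> induces D F' f -> {in D, F =1 F'}.
Proof.
move=> symD [sF hF] [sF' hF'] [a b] /set_mem Dab.
have Dab' : D (a, - b) by exact: (symD _ Dab).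
have e (a' b' : R) : D (a', b') ->
    (F (a', b')).1 + qi R * (F (a', b')).2 =
    (F' (a', b')).1 + qi R * (F' (a', b')).2.
  move=> Dz; have SJ := qi_sphere.
  rewrite -(sliceIE sF Dz SJ) -(sliceIE sF' Dz SJ) -hF -?hF' //;
    by apply/mem_set; apply: Omega_slice.
have [f1 f2] := sF _ Dab; have [g1 g2] := sF' _ Dab.
have := e _ _ Dab'; rewrite /cconj /= in f1 f2 g1 g2.
rewrite f1 f2 g1 g2; have := e _ _ Dab.
case: (F (a, b)) (F' (a, b)) => [p q] [p' q'] /= h h'.
have pp' : p = p'.
  have : 2%:R *: p = 2%:R *: p'.
    rewrite !scaler_nat !mulr2n.
    have -> : p + p = (p + qi R * q) + (p + qi R * - q).
      by rewrite mulrN addrACA subrr addr0.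
    by rewrite h h' mulrN addrACA subrr addr0.
  by apply: scalerI; rewrite pnatr_eq0.
move: h; rewrite pp' => /addrI h; congr (_, _).
have u : qi R \is a GRing.unit by exact: (imag_sphere_neq0 qi_sphere).
exact: (mulrI u).
Qed.

Lemma Omega_off_real D :
  Omega (off_real D) = Omega D `&` [set x | qIm x != 0].
Proof.
apply/seteqP; split=> [x [a [b [J [[Dab /= bn0] SJ ->]]]]|
                       x [[a [b [J [Dab SJ ->]]]]]].
- split; first exact: Omega_slice.
  by rewrite /mkset qIm_slice// scaler_eq0 negb_or bn0 imag_sphere_neq0.
- rewrite /mkset qIm_slice// scaler_eq0 negb_or => /andP[bn0 _].
  by exists a, b, J.
Qed.

Lemma spherical_derivative_induced D F f : conj_symmetric D ->
  induces D F f ->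
  induces (off_real D) (fun z => (z.2^-1 *: (F z).2, 0)) (spherical_derivative f).
Proof.
move=> symD [sF hF].
have st : is_stem (off_real D) (fun z => (z.2^-1 *: (F z).2, 0)).
  move=> z [Dz _] /=; have [_ h] := sF _ Dz.
  by rewrite h invrN scaleNr scalerN opprK oppr0.
split=> // x /set_mem [a [b [J [Dz SJ ->]]]].
rewrite (sliceIE st Dz SJ) /= mulr0 addr0; case: Dz => Dab /= bn0.
have Dab' : D (a, - b) by exact: (symD _ Dab).
rewrite /spherical_derivative qconj_slice// qIm_slice//.
rewrite !hF; try by apply/mem_set; apply: Omega_slice.
rewrite (sliceIE sF Dab SJ) (sliceIE sF Dab' SJ).
have [] := sF _ Dab; rewrite /cconj /= => -> ->.
rewrite mulrN opprD opprK addrACA subrr add0r -mulr2n -[X in _ * X]scaler_nat.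
rewrite -scalerAr scalerA mulVf ?pnatr_eq0// scale1r.
have u : J \is a GRing.unit by exact: (imag_sphere_neq0 SJ).
rewrite invrZ ?unitfE// -scalerAl; congr (_ *: _).
by rewrite mulrA mulVr// mul1r.
Qed.

End SliceFunctions.

(* Main.v *)
Require Import Defs.
From mathcomp Require Import all_boot all_order all_algebra.
From mathcomp Require Import all_classical all_reals all_analysis.
From mathcomp Require Import ring lra.
Import Order.TTheory GRing.Theory Num.Theory.
Import numFieldNormedType.Exports.
Local Open Scope classical_set_scope.
Local Open Scope ring_scope.

(* Write F = F_1 + sqrt(-1) F_2 for the stem function of f.  Off the real axis
   the spherical derivative has stem function F_2 / beta, and the formula is the
   Leibniz rule applied to F_2 = beta (F_2 / beta), combined with the
   Cauchy-Riemann equation d_alpha F_1 = d_beta F_2.  At a real point Im x = 0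
   kills the first summand whatever the extension of the slice derivative is;
   since F_2 vanishes on the real axis, F_2 / beta is a difference quotient of
   F_2, which by the mean value theorem and the continuity of d_beta F_2 tends
   to d_beta F_2 = d_alpha F_1. *)

(** * Directional derivatives under linear maps and scalar multiplication *)

Section Directional.
Set Implicit Arguments.
Unset Strict Implicit.
Variables (R : numFieldType) (V W : normedModType R).
Implicit Types (a v : V).

Lemma is_derive_linear_comp (W' : normedModType R) (L : {linear W -> W'})
    (f : V -> W) a v : continuous L -> derivable f a v ->
  is_derive a v (L \o f) (L ('D_v f a)).
Proof.
move=> Lc df.
suff h : (h^-1 *: (((L \o f) \o shift a) (h *: v) - (L \o f) a)) @[h --> 0^']
    --> L ('D_v f a).
  by apply: DeriveDef; [exact: cvgP h|exact: norm_cvg_lim].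
under eq_fun do rewrite /= -linearB -linearZ.
by apply: cvg_comp df _; exact: Lc.
Qed.

Lemma is_deriveZ_fun (c : V -> R) (f : V -> W) a v (dc : R) (df : W) :
  is_derive a v c dc -> is_derive a v f df ->
  is_derive a v (fun x => c x *: f x) (c a *: df + dc *: f a).
Proof.
move=> [hc <-] [hf <-].
suff h : (h^-1 *: (((fun x => c x *: f x) \o shift a) (h *: v) - c a *: f a))
    @[h --> 0^'] --> c a *: 'D_v f a + 'D_v c a *: f a.
  by apply: DeriveDef; [exact: cvgP h|exact: norm_cvg_lim].
(* [c] is continuous along [v]: its increment is [h] times a convergent quotient. *)
have c0 : (c (h *: v + a)) @[h --> 0^'] --> c a.
  have : (c a + h * (h^-1 *: ((c \o shift a) (h *: v) - c a))) @[h --> 0^']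
     --> c a + 0 * 'D_v c a.
    apply: cvgD; first exact: cvg_cst.
    by apply: cvgM => //; exact: cvg_within.
  rewrite mul0r addr0; apply: cvg_trans; apply: near_eq_cvg.
  near=> h; have h0 : h != 0 by near: h; exact: nbhs_dnbhs_neq.
  by rewrite /= -[_ *: _]/(_ * _) mulVKf// addrC subrK.
(* Leibniz splitting: the increment of [f] is weighted by the moving value of [c], that of [c] by
   the fixed value [f a]. *)
apply: cvg_trans (cvgD (cvgZ c0 hf) (cvgZ hc (cvg_cst (f a)))).
apply: near_eq_cvg; apply: nearW => h /=.
set u := c (h *: v + a); set w := f (h *: v + a).
rewrite -[LHS]/(u *: (h^-1 *: (w - f a)) + (h^-1 * (u - c a)) *: f a).
rewrite [u *: _]scalerA mulrC -!scalerA -scalerDr scalerBr scalerBl.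
by rewrite addrA subrK.
Unshelve. all: end_near.
Qed.

End Directional.

Section Components.
Set Implicit Arguments.
Unset Strict Implicit.
Variables (R : realType) (V W : normedModType R).

Lemma continuous_fst : continuous (@fst V W).
Proof. by move=> [a b]; exact: cvg_fst. Qed.

Lemma continuous_snd : continuous (@snd V W).
Proof. by move=> [a b]; exact: cvg_snd. Qed.

End Components.

(** * Vertical difference quotients at the real axis *)

Section DifferenceQuotient.
Set Implicit Arguments.
Unset Strict Implicit.
Variable R : realType.

Lemma derive_vertical (g : R * R -> R) (a t : R) :
  derivable g (a, t) ((0, 1) : R * R) ->
  is_derive t 1 (fun s => g (a, s)) ('D_((0, 1) : R * R) g (a, t)).
Proof.
have e : (fun h : R =>
      h^-1 *: (((fun s => g (a, s)) \o shift t) (h *: (1 : R)) - g (a, t))) =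
    (fun h : R =>
      h^-1 *: ((g \o shift (a, t)) (h *: ((0, 1) : R * R)) - g (a, t))).
  apply/funext => h /=; congr (_ *: (g _ - _)).
  by congr (_, _); rewrite /= -[_ *: _]/(_ * _) mulr0 add0r.
by move=> dg; apply: DeriveDef; rewrite /derivable /derive e.
Qed.

(** [b] may have either sign, so the mean value theorem is applied between [Num.min 0 b] and
    [Num.max 0 b]; the bound on [t] keeps the intermediate point close to the axis. *)
Lemma MVT_vertical (g : R * R -> R) (a b : R) :
  (forall t, `|t| <= `|b| -> derivable g (a, t) ((0, 1) : R * R)) -> b != 0 ->
  exists2 t, `|t| <= `|b| &
    b^-1 *: (g (a, b) - g (a, 0)) = 'D_((0, 1) : R * R) g (a, t).
Proof.
move=> dg b0.
have ltb t : t \in `[Num.min 0 b, Num.max 0 b] -> `|t| <= `|b|.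
  rewrite in_itv /= ler_norml; have [b1|b1] := ltP 0 b.
    by rewrite (gtr0_norm b1) => /andP[]; lra.
  by rewrite (ler0_norm b1) => /andP[]; lra.
have lt0 : Num.min 0 b < Num.max 0 b.
  by have [//|] := ltP 0 b; rewrite le_eqVlt (negPf b0).
have dh t : t \in `[Num.min 0 b, Num.max 0 b] ->
    is_derive t 1 (fun s => g (a, s)) ('D_((0, 1) : R * R) g (a, t)).
  by move=> /ltb /dg; exact: derive_vertical.
have oc t : t \in `]Num.min 0 b, Num.max 0 b[ ->
    t \in `[Num.min 0 b, Num.max 0 b] by exact: subset_itv_oo_cc.
have ch : {within `[Num.min 0 b, Num.max 0 b], continuous (fun s => g (a, s))}.
  by apply: derivable_within_continuous => t /dh [].
have [t tb e] := MVT lt0 (fun t tb => dh t (oc t tb)) ch.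
exists t; first by apply: ltb; exact: oc.
move: e; rewrite -[_ *: _]/(_ * _).
have [b1|b1] := ltP 0 b => e; last first.
  by rewrite -opprB e sub0r !mulrN opprK mulrC mulfK.
by rewrite e subr0 mulrC mulfK.
Qed.

Lemma cvg_vertical_quotient_real (g : R * R -> R) (a : R) :
  (\forall w \near (a, 0 : R), derivable g w ((0, 1) : R * R)) ->
  {for (a, 0 : R), continuous ('D_((0, 1) : R * R) g)} ->
  w.2^-1 *: (g w - g (w.1, 0))
    @[w --> within [set w : R * R | w.2 != 0] (nbhs (a, 0 : R))]
  --> 'D_((0, 1) : R * R) g (a, 0).
Proof.
move=> dg cg; apply/cvg_ballP => e e0.
have ge := cvg_ball cg e0.
have [d /= d0 dP] := (nbhs_ballP _ _).1 (filterI dg (ge _)).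
rewrite near_withinE; apply/nbhs_ballP; exists d => // -[u v] /= [ua va] v0.
(* Balls of the product are boxes, so moving towards the axis stays inside. *)
have tP t : `|t| <= `|v| -> ball (a, 0 : R) d (u, t).
  move=> tv; split=> //=; move: va; rewrite /ball /= !sub0r !normrN.
  exact: le_lt_trans.
have [t tv ->] := MVT_vertical (fun t tv => (dP _ (tP t tv)).1) v0.
exact: (dP _ (tP t tv)).2.
Qed.

(* As a property of V it passes from factors to products, which reduces the
   quaternion-valued case to the real mean value theorem. *)
Definition vertical_quotient_cvg (V : normedModType R) :=
  forall (g : R * R -> V) (a : R),
  (\forall w \near (a, 0 : R), derivable g w ((0, 1) : R * R)) ->
  {for (a, 0 : R), continuous ('D_((0, 1) : R * R) g)} ->
  w.2^-1 *: (g w - g (w.1, 0))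
    @[w --> within [set w : R * R | w.2 != 0] (nbhs (a, 0 : R))]
  --> 'D_((0, 1) : R * R) g (a, 0).

Lemma linear_comp_vertical (V W : normedModType R) (L : {linear V -> W})
    (g : R * R -> V) (a : R) : continuous L ->
  (\forall w \near (a, 0 : R), derivable g w ((0, 1) : R * R)) ->
  {for (a, 0 : R), continuous ('D_((0, 1) : R * R) g)} ->
  (\forall w \near (a, 0 : R), derivable (L \o g) w ((0, 1) : R * R)) /\
  {for (a, 0 : R), continuous ('D_((0, 1) : R * R) (L \o g))}.
Proof.
move=> Lc dg cg; split.
  by apply: filterS dg => w dw; have [] := is_derive_linear_comp Lc dw.
have e w : derivable g w ((0, 1) : R * R) ->
    'D_((0, 1) : R * R) (L \o g) w = L ('D_((0, 1) : R * R) g w).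
  by move=> dw; have [] := is_derive_linear_comp Lc dw.
rewrite /prop_for /continuous_at (e _ (nbhs_singleton dg)).
have := cvg_comp _ _ cg (Lc _).
by apply: cvg_trans; apply: near_eq_cvg; apply: filterS dg => w /e ->.
Qed.

Lemma vertical_quotient_cvg_pair (V W : normedModType R) :
  vertical_quotient_cvg V -> vertical_quotient_cvg W ->
  vertical_quotient_cvg (V * W)%type.
Proof.
move=> hV hW g a dg cg.
have [dg1 cg1] := linear_comp_vertical (L := fst) (@continuous_fst _ _ _) dg cg.
have [dg2 cg2] := linear_comp_vertical (L := snd) (@continuous_snd _ _ _) dg cg.
have := cvg_pair (hV _ _ dg1 cg1) (hW _ _ dg2 cg2).
have dg0 := nbhs_singleton dg.
have [_ ->] := is_derive_linear_comp (L := fst) (@continuous_fst _ _ _) dg0.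
have [_ ->] := is_derive_linear_comp (L := snd) (@continuous_snd _ _ _) dg0.
by move=> h; rewrite [X in _ --> X]surjective_pairing; exact: h.
Qed.

(** [quat R] is a nest of pairs over [R]. The mean value theorem gives each component its own
    intermediate point, but limits can be taken componentwise. *)
Lemma vertical_quotient_cvg_quat : vertical_quotient_cvg (quat R).
Proof.
have h := cvg_vertical_quotient_real.
have h2 := vertical_quotient_cvg_pair h h.
have h3 := vertical_quotient_cvg_pair h2 h.
exact: (vertical_quotient_cvg_pair h3 h).
Qed.

End DifferenceQuotient.

(** * Derivatives of pairs and of 1 / beta *)

Section PairDerivative.
Set Implicit Arguments.
Unset Strict Implicit.

Lemma is_derive_pair (R : numFieldType) (U V W : normedModType R)
    (f : U -> V) (g : U -> W) (a v : U) (df : V) (dg : W) :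
  is_derive a v f df -> is_derive a v g dg ->
  is_derive a v (fun x => (f x, g x)) (df, dg).
Proof.
move=> [hf <-] [hg <-].
have h : (h^-1 *: (((fun x => (f x, g x)) \o shift a) (h *: v) - (f a, g a)))
    @[h --> 0^'] --> ('D_v f a, 'D_v g a).
  exact: cvg_pair hf hg.
by apply: DeriveDef; [exact: cvgP h|exact: norm_cvg_lim].
Qed.

Variable R : realType.

Lemma is_derive_inv_snd (z v : R * R) : z.2 != 0 ->
  is_derive z v (fun w : R * R => w.2^-1) (- z.2 ^- 2 * v.2).
Proof.
move=> z0.
have did : derivable (@id (R * R)) z v by exact: derivable_id.
have [d2 e2] := is_derive_linear_comp (L := snd) (@continuous_snd _ _ _) did.
have d : derivable (@snd R R) z v by exact: d2.
apply: DeriveDef; first exact: derivableV.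
by rewrite deriveV // [X in _ *: X]e2 derive_id.
Qed.

End PairDerivative.

(** * Slice coordinates, stem derivatives and limits at real points *)

Section Regular.
Set Implicit Arguments.
Unset Strict Implicit.
Variable R : realType.
Implicit Types (D : set (cplane R)) (F : cplane R -> HC R).
Implicit Types (f g : quat R -> quat R) (x : quat R).

Definition slice_coords x : cplane R := (qRe x, qabs (qIm x)).

Lemma qabs0 : qabs (0 : quat R) = 0.
Proof.
have : qnorm2 (0 : quat R) == 0 by rewrite qnorm2_eq0.
by rewrite /qabs => /eqP ->; rewrite sqrtr0.
Qed.

Lemma imag_unit_sphere x : imag_sphere (imag_unit x).
Proof.
rewrite /imag_unit; case: ifPn => [_|x0]; first exact: qi_sphere.
have n0 : 0 < qnorm2 (qIm x).
  by rewrite lt_neqAle eq_sym qnorm2_eq0 x0 qnorm2_ge0.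
apply/imag_sphereP; split.
  by case: x {x0 n0} => [[[a b] c] d]; rewrite qscaleE /= mulr0.
have -> : qnorm2 ((qabs (qIm x))^-1 *: qIm x) =
    (qabs (qIm x)) ^- 2 * qnorm2 (qIm x).
  rewrite -exprVn; case: (qIm x) => [[[a b] c] d].
  by rewrite qscaleE /qnorm2; ring.
by rewrite sqr_sqrtr ?qnorm2_ge0// mulVf ?gt_eqF.
Qed.

Lemma qIm_polar x : qIm x = qabs (qIm x) *: imag_unit x.
Proof.
rewrite /imag_unit; case: eqVneq => [->|x0]; first by rewrite qabs0 scale0r.
by rewrite scalerA mulfV ?scale1r// /qabs gt_eqF// sqrtr_gt0 lt_neqAle eq_sym
  qnorm2_eq0 x0 qnorm2_ge0.
Qed.

(** A representation of [x] may have [b < 0]; symmetry then supplies the point with ordinate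
    [- b]. *)
Lemma Omega_coords D x : conj_symmetric D -> Omega D x -> D (slice_coords x).
Proof.
move=> symD [a [b [J [Dab SJ ->]]]].
rewrite /slice_coords qRe_slice// qIm_slice// qabs_slice//.
by have [//|_] := ger0P b; exact: (symD _ Dab).
Qed.

Lemma stem_real F D (a : R) : is_stem D F -> D (a, 0) -> (F (a, 0)).2 = 0.
Proof.
move=> st Da; have [_] := st _ Da; rewrite /cconj /= oppr0 => h.
have : 2%:R *: (F (a, 0)).2 = 0 by rewrite scaler_nat mulr2n {1}h addNr.
by move=> /eqP; rewrite scaler_eq0 pnatr_eq0 => /eqP.
Qed.

Lemma conj_symmetric_off_real D : conj_symmetric D -> conj_symmetric (off_real D).
Proof. by move=> symD z [Dz z0]; split; [exact: symD|rewrite /= oppr_eq0]. Qed.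

Lemma open_off_real D : open D -> open (off_real D).
Proof.
move=> oD; apply: openI => //.
have -> : [set z : cplane R | z.2 != 0] = snd @^-1` [set t : R | t != 0] by [].
apply: open_comp; last exact: open_neq.
by move=> z _; exact: continuous_snd.
Qed.

(** [stem_function D f] is a choice that agrees with [F] on [D]; since [D] is open they agree near
    the point, hence so do their derivatives. *)
Lemma slice_derivativeE D F f x : open D -> conj_symmetric D ->
  induces D F f -> Omega D x -> slice_derivative D f x = sliceI (d_z F) x.
Proof.
move=> oD symD iF Ox.
have iS : induces D (stem_function D f) f.
  exact: (@xgetPex _ (cst 0) [set F | induces D F f] (ex_intro _ F iF)).
have Dz := Omega_coords symD Ox.
have e : \forall w \near slice_coords x, stem_function D f w = F w.
  apply: filterS (open_nbhs_nbhs (conj oD Dz)) => w Dw.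
  exact: (stem_function_unique symD iS iF (mem_set Dw)).
rewrite /slice_derivative /sliceI -/(slice_coords x) /d_z /d_alpha /d_beta.
by rewrite !(near_eq_derive _ e).
Qed.

(** The hypothesis amounts to [d_alpha F z = - HCi (d_beta F z)]; inserted in [d_z], it gives half
    of twice [d_alpha F z]. *)
Lemma cauchy_riemann F z : d_zbar F z = 0 ->
  (d_alpha F z).1 = (d_beta F z).2 /\ d_z F z = d_alpha F z.
Proof.
rewrite /d_zbar /d_z => /eqP; rewrite scaler_eq0 invr_eq0 pnatr_eq0 /= addr_eq0.
move=> /eqP e; split; first by rewrite e /= opprK.
rewrite -[HCi _]opprK -e opprK -mulr2n -[X in _ *: X]scaler_nat scalerA.
by rewrite mulVf ?pnatr_eq0// scale1r.
Qed.

Lemma d_z_spherical D F z : is_C1 D F -> off_real D z ->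
  d_z (fun w => (w.2^-1 *: (F w).2, 0)) z =
  2^-1 *: (z.2^-1 *: (d_alpha F z).2,
           z.2 ^- 2 *: (F z).2 - z.2^-1 *: (d_beta F z).2).
Proof.
move=> C1 [Dz /= z0]; have [da db _ _] := C1 _ Dz.
(* [t] is the rate of change of beta along [v]: 0 for alpha, 1 for beta. *)
have dS (v : cplane R) (t : R) : v.2 = t -> derivable F z v ->
    'D_v (fun w : cplane R => (w.2^-1 *: (F w).2, 0 : quat R)) z =
    (z.2^-1 *: ('D_v F z).2 + (- z.2 ^- 2 * t) *: (F z).2, 0).
  move=> <- dF.
  have d2 := is_derive_linear_comp (L := snd) (@continuous_snd _ _ _) dF.
  have d1 := is_deriveZ_fun (is_derive_inv_snd v z0) d2.
  by have [_ ->] := is_derive_pair d1 (is_derive_cst (0 : quat R) z v).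
have ea := dS (1, 0) 0 erefl da; have eb := dS (0, 1) 1 erefl db.
rewrite mulr0 scale0r addr0 -/(d_alpha F z) in ea.
rewrite mulr1 scaleNr -/(d_beta F z) in eb.
rewrite /d_z {1}/d_alpha {1}/d_beta ea eb.
have E (p q r : quat R) : ((p, 0) : HC R) - HCi (q - r, 0) = (p, r - q).
  transitivity ((p - - 0, 0 - (q - r)) : HC R) => //.
  by rewrite opprK addr0 sub0r opprB.
by rewrite E.
Qed.

(** F_2 vanishes on the real axis and small real shifts stay in the open set [D], so the difference
    quotients are eventually zero. *)
Lemma d_alpha_real D F (a : R) : open D -> is_stem D F -> D (a, 0) ->
  derivable F (a, 0) ((1, 0) : cplane R) -> (d_alpha F (a, 0)).2 = 0.
Proof.
move=> oD st Da dF.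
have [d2 e2] := is_derive_linear_comp (L := snd) (@continuous_snd _ _ _) dF.
rewrite /d_alpha -[LHS]e2.
have c0 : (fun=> 0 : quat R) @ (0 : R)^' --> (0 : quat R) by exact: cvg_cst.
apply: norm_cvg_lim; apply: cvg_trans c0.
apply: near_eq_cvg.
have Dh : \forall h \near (0 : R)^', D (h *: ((1, 0) : cplane R) + (a, 0)).
  have : (h *: ((1, 0) : cplane R) + (a, 0)) @[h --> (0 : R)^']
      --> 0 *: ((1, 0) : cplane R) + (a, 0).
    by apply: cvgD; [apply: cvgZr_tmp; exact: cvg_within|exact: cvg_cst].
  rewrite scale0r add0r; apply.
  exact: open_nbhs_nbhs.
apply: filterS Dh => h Dh /=.
have e : h *: ((1, 0) : cplane R) + (a, 0) = (h * 1 + a, 0 : R).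
  by congr (_, _); rewrite /= -[_ *: _]/(_ * _) mulr0 addr0.
rewrite e in Dh *; rewrite (stem_real st Da) (stem_real st Dh).
by rewrite subr0 scaler0.
Qed.

(** Unlike [imag_unit], these coordinates are continuous at real points too, so limits in the plane
    pull back to the quaternions. *)
Lemma slice_coords_continuous : continuous slice_coords.
Proof.
have e : slice_coords = fun y : R * R * R * R => (y.1.1.1,
    Num.sqrt (0 ^+ 2 + y.1.1.2 ^+ 2 + y.1.2 ^+ 2 + y.2 ^+ 2)).
  by apply/funext => -[[[a b] c] d].
rewrite e => x.
have c1 (y : R * R * R * R) : y.1 @[y --> y] --> y.1 by exact: continuous_fst.
have c11 : y.1.1 @[y --> x] --> x.1.1.
  exact: (cvg_comp _ _ (c1 x) (@continuous_fst _ _ _ _)).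
have c111 : y.1.1.1 @[y --> x] --> x.1.1.1.
  exact: (cvg_comp _ _ c11 (@continuous_fst _ _ _ _)).
have sq (u : R * R * R * R -> R) : u y @[y --> x] --> u x ->
    (u y) ^+ 2 @[y --> x] --> (u x) ^+ 2.
  by move=> h; apply: (cvg_comp _ _ h (@exprn_continuous _ _ _)).
have cn : 0 ^+ 2 + y.1.1.2 ^+ 2 + y.1.2 ^+ 2 + y.2 ^+ 2 @[y --> x] -->
    0 ^+ 2 + x.1.1.2 ^+ 2 + x.1.2 ^+ 2 + x.2 ^+ 2.
  apply: cvgD; last by apply: sq; exact: continuous_snd.
  apply: cvgD; last first.
    by apply: sq; exact: (cvg_comp _ _ (c1 x) (@continuous_snd _ _ _ _)).
  apply: cvgD; first exact: cvg_cst.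
  by apply: sq; exact: (cvg_comp _ _ c11 (@continuous_snd _ _ _ _)).
exact: (cvg_pair c111 (cvg_comp _ _ cn (@sqrt_continuous _ _))).
Qed.

(** Properness makes limits unique, so that convergence determines the [lim] in [extend_real]. A
    real [x] is approached by [x + t i] with [t] nonzero. *)
Lemma within_off_real_proper D x : open D -> conj_symmetric D -> Omega D x ->
  qIm x = 0 -> ProperFilter (within (Omega (off_real D)) (nbhs x)).
Proof.
move=> oD symD Ox x0.
have Da : D (qRe x, 0).
  by have := Omega_coords symD Ox; rewrite /slice_coords x0 qabs0.
have ex : x = (qRe x)%:A.
  case: x x0 {Ox Da} => [[[a b] c] d] [-> -> ->].
  by rewrite qoneE qscaleE /= mulr1 !mulr0.
apply: Build_ProperFilter_ex => P; rewrite /within /= => nP.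
have cx : ((qRe x)%:A + t *: qi R) @[t --> (0 : R)^'] --> x.
  rewrite {2}ex -[X in _ --> X]addr0 -[X in _ --> _ + X](scale0r (qi R)).
  by apply: cvgD; [exact: cvg_cst|apply: cvgZr_tmp; exact: cvg_within].
have cD : (qRe x, t) @[t --> (0 : R)^'] --> (qRe x, 0 : R).
  exact: (cvg_pair (cvg_cst _) (cvg_within _)).
have nD : \forall t \near (0 : R)^', D (qRe x, t).
  exact: (cD _ (open_nbhs_nbhs (conj oD Da))).
have nP' : \forall t \near (0 : R)^',
    Omega (off_real D) ((qRe x)%:A + t *: qi R) ->
    P ((qRe x)%:A + t *: qi R) by exact: (cx _ nP).
have [t [[Pt Dt] t0]] := filter_ex (filterI (filterI nP' nD)
  (nbhs_dnbhs_neq (0 : R))).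
exists ((qRe x)%:A + t *: qi R); apply: Pt.
by exists (qRe x), t, (qi R); split=> //; exact: qi_sphere.
Qed.

(** The stem function F_2 / beta has zero second component, so [imag_unit] drops out and a quotient
    of F_2 composed with [slice_coords] remains. *)
Lemma spherical_derivative_cvg D F f x : open D -> conj_symmetric D ->
  induces D F f -> is_C1 D F -> Omega D x -> qIm x = 0 ->
  spherical_derivative f y @[y --> within (Omega (off_real D)) (nbhs x)]
    --> (d_beta F (slice_coords x)).2.
Proof.
move=> oD symD iF C1 Ox x0.
have Da := Omega_coords symD Ox.
have ez : slice_coords x = (qRe x, 0) by rewrite /slice_coords x0 qabs0.
rewrite ez in Da *.
have [_ db _ cb] := C1 _ Da.
have nD := open_nbhs_nbhs (conj oD Da).
have dn : \forall w \near (qRe x, 0 : R), derivable F w ((0, 1) : cplane R).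
  by apply: filterS nD => w /C1[].
have [dn2 cb2] := linear_comp_vertical (L := snd) (@continuous_snd _ _ _) dn cb.
have q := vertical_quotient_cvg_quat dn2 cb2.
have [_ e2] := is_derive_linear_comp (L := snd) (@continuous_snd _ _ _) db.
rewrite e2 in q.
have cc : slice_coords y @[y --> within (Omega (off_real D)) (nbhs x)]
    --> within [set w : cplane R | w.2 != 0] (nbhs (qRe x, 0 : R)).
  move=> P; rewrite /= /within /= -ez => nP.
  have nxP : \forall y \near x, (slice_coords y).2 != 0 -> P (slice_coords y).
    exact: slice_coords_continuous nP.
  rewrite near_simpl; apply: filterS nxP => y Py Oy; apply: Py.
  by have [] := Omega_coords (conj_symmetric_off_real symD) Oy.
apply: cvg_trans (cvg_comp _ _ cc q); apply: near_eq_cvg.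
(* The subtracted value of F_2 on the axis is known to vanish only at points of [D]; openness puts
   the foot of each nearby point there. *)
have nD0 : \forall y \near x, D ((slice_coords y).1, 0).
  have : ((slice_coords y).1, 0 : R) @[y --> x] --> ((slice_coords x).1, 0 : R).
    exact: (cvg_pair (cvg_comp _ _ (@slice_coords_continuous _)
      (@continuous_fst _ _ _ _)) (cvg_cst _)).
  by rewrite ez /=; apply.
apply: filterS nD0 => y Dy Oy.
have [_ ->] := spherical_derivative_induced symD iF; last exact: mem_set.
rewrite /sliceI -/(slice_coords y) /= mulr0 addr0.
by rewrite (stem_real iF.1 Dy) subr0.
Qed.

(** Here [p], [q], [r] stand for d_alpha F_2, d_beta F_2 and F_2 at ordinate [b]. The factor 2
    cancels the [2^-1] of [d_z], and the two multiples of [r] cancel each other. *)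
Lemma slice_leibniz_identity (J p q r : quat R) (b : R) : J * J = -1 -> b != 0 ->
  q + J * p = 2%:R * (b *: J) *
    ((2^-1 *: ((b^-1 *: p, b ^- 2 *: r - b^-1 *: q) : HC R)).1 +
     J * (2^-1 *: ((b^-1 *: p, b ^- 2 *: r - b^-1 *: q) : HC R)).2)
    + (b^-1 *: r + J * 0).
Proof.
move=> J2 b0 /=; set u := b^-1 *: p; set w := b ^- 2 *: r - b^-1 *: q.
have -> : 2%:R * (b *: J) * (2^-1 *: u + J * (2^-1 *: w)) = b *: (J * u - w).
  rewrite mulr_natl -scaler_nat scalerA -scalerAl mulrDr mulrA -!scalerAr.
  rewrite J2 mulN1r -scalerDr scalerA; congr (_ *: _).
  by rewrite mulrAC divff ?mul1r// pnatr_eq0.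
have bV : b * b ^- 2 = b^-1 by field.
rewrite scalerBr scalerAr /u /w scalerBr !scalerA bV mulfV// !scale1r.
by rewrite mulr0 addr0 opprB addrA subrK addrC.
Qed.

End Regular.

(** * The formula, at real points and off the real axis *)

Theorem proposition25 (R : realType) (D : set (cplane R))
    (f : quat R -> quat R) :
  open D -> conj_symmetric D -> slice_regular D f ->
  forall x : quat R, Omega D x ->
    slice_derivative D f x =
      2%:R * qIm x *
        extend_real D
          (slice_derivative (off_real D) (spherical_derivative f)) x
      + extend_real D (spherical_derivative f) x.
Proof.
move=> oD symD [F [iF C1 reg]] x Ox.
have Dz := Omega_coords symD Ox.
have [CR dzE] := cauchy_riemann (reg _ Dz).
(* The left side becomes d_beta F_2 + J d_alpha F_2. *)
rewrite (slice_derivativeE oD symD iF Ox) /sliceI -/(slice_coords x) dzE CR.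
rewrite /extend_real; case: eqVneq => [x0|x0].
  have Px := within_off_real_proper oD symD Ox x0.
  rewrite x0 mulr0 mul0r add0r.
  rewrite (norm_cvg_lim (spherical_derivative_cvg oD symD iF C1 Ox x0)).
  have ez : slice_coords x = (qRe x, 0) by rewrite /slice_coords x0 qabs0.
  rewrite ez in Dz *; have [da _ _ _] := C1 _ Dz.
  (* Only the term J d_alpha F_2 is left over, and it vanishes on the real axis. *)
  move: (d_alpha F _) (d_beta F _) (d_alpha_real oD iF.1 Dz da) => w w' ->.
by rewrite mulr0 addr0.
(* Off the axis the spherical derivative is itself a slice function, on the open symmetric set
   [off_real D], so its slice derivative is computed from F_2 / beta. *)
have Ox' : Omega (off_real D) x by rewrite Omega_off_real.
have symD' := conj_symmetric_off_real symD.
have iS := spherical_derivative_induced symD iF.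
rewrite (slice_derivativeE (open_off_real oD) symD' iS Ox').
rewrite (iS.2 _ (mem_set Ox')) /sliceI -/(slice_coords x).
have Oz := Omega_coords symD' Ox'; have z0 : (slice_coords x).2 != 0 := Oz.2.
rewrite (d_z_spherical C1 Oz).
have J2 : imag_unit x * imag_unit x = -1 by exact: imag_unit_sphere.
rewrite qIm_polar -[qabs _]/(slice_coords x).2.
exact: slice_leibniz_identity.
Qed.
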